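(* Let $p>2$ be a prime and let $G$ be a finite non-abelian $d$-maximal $p$-group with $d(G)=3$. Then $G$ is isomorphic to the central product $C_{p^2}*S$, where $S$ is the extraspecial $p$-group of order $p^3$ and exponent $p$; in other words, $$G=\langle a,b,c\mid a^{p^{2}}=b^{p}=c^{p}=1,\ [a,b]=[a,c]=1,\ [b,c]=a^{p}\rangle.$$
   Context: All groups are finite. For a finite $p$-group $G$, $d(G)$ denotes the minimal number of generators of $G$. A finite $p$-group $G$ is called $d$-maximal if $d(H)<d(G)$ for every proper subgroup $H<G$. $C_{p^2}$ is the cyclic group of order $p^2$; the central product $C_{p^2}*S$ amalgamates the subgroup of order $p$ of $C_{p^2}$ with $Z(S)$. *)

(* Defs.v *)
(* Mathematical Components: finite groups; 'm(G) is d(G), the least size of a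
   generating set of G. *)
From mathcomp Require Import all_boot all_fingroup all_solvable.

Set Implicit Arguments.
Unset Strict Implicit.
Unset Printing Implicit Defensive.

Local Open Scope group_scope.

Definition d_maximal (gT : finGroupType) (G : {group gT}) : Prop :=
  forall H : {group gT}, H \proper G -> 'm(H) < 'm(G).

(* G is isomorphic to the central product C_{p^2} * S, given by the images C
   and S in G of the two factors.  The last two conditions say that the factors
   meet exactly in the amalgamated subgroup: 'Ohm_1(C) is the subgroup of order
   p of C, and it is identified with 'Z(S). *)
Definition cprod_cyclic_extraspecial
    (p : nat) (gT : finGroupType) (G : {group gT}) : Prop :=
  exists C S : {group gT},
    [/\ cyclic C /\ #|C| = (p ^ 2)%N,
        [/\ extraspecial S, #|S| = (p ^ 3)%N & exponent S = p],
        C \* S = G,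
        C :&: S = 'Z(S)
      & 'Ohm_1(C) = 'Z(S)].

(* Main.v *)
(* Elementary abelian subgroups of G have order at most p^2, and quotients of
   G by subgroups of 'Phi(G) are again d-maximal with three generators. Hence
   G / G^`(1) is elementary abelian and G^`(1) = 'Phi(G).
   If G has class 2, then x |-> x^p is a morphism from G to G^`(1), so its
   kernel S has order at least p^3. As S has exponent p and contains no
   elementary abelian subgroup of order p^3, its center is G^`(1) and has order
   p; so S is extraspecial of order p^3, G has order p^4, and S together with
   its centralizer C gives G as a central product. C is cyclic since the
   elements outside S have order p^2.
   If G had class at least 3, a quotient of G would have N = [~: G^`(1), G] of
   order p, and G / N would be such a central product. Lift a generator of its
   cyclic factor to x in G: then [~ x, y] lies in N for all y in G, so
   [~ x ^+ p, y] = [~ x, y] ^+ p = 1, and G^`(1) = N <*> <[x ^+ p]> would be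
   central. *)
Require Import Defs.
From mathcomp Require Import all_boot all_fingroup all_solvable.

Set Implicit Arguments.
Unset Strict Implicit.
Unset Printing Implicit Defensive.

Local Open Scope group_scope.

(** * Generator numbers and quotients of d-maximal groups *)

Lemma grank_quotient_Phi (gT : finGroupType) (G N : {group gT}) :
  N <| G -> N \subset 'Phi(G) -> 'm(G / N) = 'm(G).
Proof.
move=> nsNG sNPhi; have [sNG nNG] := andP nsNG.
apply/eqP; rewrite eqn_leq quotient_grank //=.
have [B genB <-] := grank_witness (G / N)%G.
have sBG : B \subset G / N by rewrite -[_ / _]genB subset_gen.
pose X := [set repr (x : coset_of N) | x in B].
have defB : [set coset N x | x in X] = B.
  rewrite -imset_comp -[RHS]imset_id; apply: eq_imset => x /=.
  exact: coset_reprK.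
have sXG : X \subset G.
  apply/subsetP=> _ /imsetP[x Bx ->].
  have /morphimP[y Ny Gy defx] := subsetP sBG x Bx.
  have : repr x \in N :* y by rewrite -val_coset // -defx mem_repr_coset.
  by case/rcosetP=> z Nz ->; rewrite groupM // (subsetP sNG).
suffices <- : <<X>> = G by rewrite (leq_trans (grank_min _)) ?leq_imset_card.
apply: Phi_nongen; apply/eqP; rewrite eqEsubset join_subG Phi_sub sXG /=.
have sNX : N <*> <<X>> \subset 'Phi(G) <*> X.
  by rewrite joing_idr genS // setSU.
apply: subset_trans sNX; rewrite norm_joinEr ?gen_subG ?(subset_trans sXG) //.
rewrite -quotientSK //.
rewrite quotient_gen ?(subset_trans sXG) //.
have -> : X / N = B by rewrite /quotient morphimEsub ?(subset_trans sXG).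
by rewrite genB.
Qed.

Lemma d_maximal_quotient (gT : finGroupType) (G N : {group gT}) :
  N <| G -> N \subset 'Phi(G) -> d_maximal G -> d_maximal (G / N)%G.
Proof.
move=> nsNG sNPhi dmaxG K; rewrite properE => /andP[sKG not_sGK] /=.
have [H defK sNH sHG] := inv_quotientS nsNG sKG.
rewrite grank_quotient_Phi // defK.
apply: leq_ltn_trans (dmaxG H _).
  by apply: quotient_grank; apply: subset_trans sHG (normal_norm nsNG).
rewrite properE sHG; apply: contra not_sGK => sGH.
by rewrite defK quotientS.
Qed.

(** For abelian [G], ['Ohm_1(G)] has the same rank as [G], so it cannot be proper. *)
Lemma d_maximal_abelian_abelem (p : nat) (gT : finGroupType) (G : {group gT}) :
  p.-group G -> abelian G -> d_maximal G -> p.-abelem G.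
Proof.
move=> pG cGG dmaxG; apply/abelem_Ohm1P=> //; apply/eqP.
rewrite eqEproper Ohm_sub /=; apply/negP=> /dmaxG.
by rewrite /= !grank_abelian ?(abelianS (Ohm_sub 1 G)) //= rank_Ohm1 ltnn.
Qed.

Lemma d_maximal_der1 (p : nat) (gT : finGroupType) (G : {group gT}) :
  p.-group G -> d_maximal G -> G^`(1) = 'Phi(G).
Proof.
move=> pG dmaxG; apply/eqP.
have sG'Phi : G^`(1) \subset 'Phi(G) by rewrite (Phi_joing pG) joing_subl.
rewrite eqEsubset sG'Phi (Phi_min pG) ?der_norm //.
apply: d_maximal_abelian_abelem; rewrite ?quotient_pgroup //.
  exact: (der_abelian 0).
by apply: d_maximal_quotient; rewrite ?der_normal.
Qed.

Lemma grank_pgroup (p : nat) (gT : finGroupType) (G : {group gT}) :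
  p.-group G -> 'm(G) = logn p #|G / 'Phi(G)|.
Proof.
move=> pG; have abelQ := Phi_quotient_abelem pG.
rewrite -(@grank_quotient_Phi _ G 'Phi(G)) ?Phi_normal //.
by rewrite grank_abelian ?(abelem_abelian abelQ) //= (rank_abelem abelQ).
Qed.

Lemma d_maximal_abelem (p : nat) (gT : finGroupType) (G E : {group gT}) :
  ~~ abelian G -> d_maximal G -> p.-abelem E -> E \subset G ->
  logn p #|E| < 'm(G).
Proof.
move=> not_cGG dmaxG abelE sEG.
rewrite -(rank_abelem abelE) -grank_abelian ?(abelem_abelian abelE) //.
apply: dmaxG; rewrite properEneq sEG andbT.
apply: contraNneq not_cGG => /val_inj/(congr1 val)/= <-.
exact: abelem_abelian abelE.
Qed.

(** * Groups of class 2 *)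

Lemma d_maximal_class2 (p : nat) (gT : finGroupType) (G : {group gT}) :
    prime p -> 2 < p -> p.-group G -> ~~ abelian G -> d_maximal G ->
    'm(G) = 3 -> G^`(1) \subset 'Z(G) ->
  cprod_cyclic_extraspecial p G.
Proof.
move=> p_pr p_gt2 pG not_cGG dmaxG dG sG'Z.
have odd_p : odd p by have [p2|] := even_prime p_pr; first rewrite p2 in p_gt2.
have p_gt1 := prime_gt1 p_pr.
have defPhi := d_maximal_der1 pG dmaxG.
have Gp x : x \in G -> x ^+ p \in G^`(1).
  by move=> Gx; rewrite defPhi (Phi_joing pG) mem_gen // inE (Mho_p_elt 1)
    ?(mem_p_elt pG) ?orbT.
have cG'G x y : x \in G^`(1) -> y \in G -> commute x y.
  by move=> G'x Gy; apply/commute_sym/(centerC Gy)/(subsetP sG'Z).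
have commXp x y : x \in G -> y \in G -> [~ x, y] ^+ p = 1.
  move=> Gx Gy; rewrite -commXg; last first.
    by apply/commute_sym/cG'G=> //; apply: mem_commg.
  by apply/eqP/commgP/cG'G; first exact: Gp.
have powM : {in G &, {morph natexp^~ p : x y / x * y}}.
  move=> x y Gx Gy; have G'yx := mem_commg Gy Gx.
  rewrite expMg_Rmul; try by apply/commute_sym/cG'G.
  (* The correction term is [[~ y, x]] to the power ['C(p, 2)], a multiple of [p] because [p] is
     odd. *)
  rewrite bin2odd // expgM commXp // expg1n mulg1 //.
have oGG' : #|G : G^`(1)| = (p ^ 3)%N.
  rewrite /= defPhi -card_quotient ?gFnorm // -dG (grank_pgroup pG).
  by rewrite -card_pgroup ?quotient_pgroup.
(* [S] is the kernel of the power map; the image lies in [G^](1)[, so the kernel is at least as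
   large as the index of]G^[(1)]. *)
have [S memS leS] : exists2 S : {group gT},
    forall x, (x \in S) = (x \in G) && (x ^+ p == 1) & p ^ 3 <= #|S|.
  exists ('ker (Morphism powM))%G => [x|]; first by rewrite !inE.
  rewrite -oGG' -(leq_pmul2l (cardG_gt0 G^`(1)%G)) Lagrange ?der_sub //.
  rewrite -(Lagrange (subsetIl G _ : 'ker (Morphism powM) \subset G)) mulnC.
  rewrite leq_pmul2r ?cardG_gt0 //.
  have := card_morphim (Morphism powM) G; rewrite setIid => <-.
  by apply/subset_leq_card/subsetP=> _ /morphimP[x _ Gx ->]; apply: Gp.
have sSG : S \subset G by apply/subsetP=> x; rewrite memS => /andP[].
have pS : p.-group S := pgroupS sSG pG.
have expS : exponent S %| p.
  by apply/exponentP=> x; rewrite memS => /andP[_ /eqP].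
have sG'S : G^`(1) \subset S.
  rewrite gen_subG; apply/subsetP=> _ /imset2P[x y Gx Gy ->].
  by rewrite memS groupR //= commXp.
have pPhi : p.-group G^`(1) := pgroupS (der_sub 1 G) pG.
have smallE (E : {group gT}) : E \subset S -> abelian E -> #|E| <= p ^ 2.
  move=> sES cEE.
  have abelE : p.-abelem E.
    by rewrite abelemE // cEE (dvdn_trans (exponentS sES)).
  have := d_maximal_abelem not_cGG dmaxG abelE (subset_trans sES sSG).
  rewrite dG [in #|E| <= _](card_pgroup (abelem_pgroup abelE)) leq_exp2l //.
have not_cSS : ~~ abelian S.
  apply: contraL leS => cSS.
  rewrite -ltnNge (leq_ltn_trans (smallE _ (subxx S) cSS)) //.
  by rewrite ltn_exp2l.
have sG'ZS : G^`(1) \subset 'Z(S).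
  rewrite subsetI sG'S (subset_trans sG'Z) //.
  by rewrite (subset_trans (subsetIr _ _)) ?centS.
have ntG' : G^`(1) != 1 by rewrite derg1 (sameP eqP commG1P).
(* If ['Z(S)] had order at least [p ^ 2], adjoining a noncentral [x] of [S] would give an abelian
   subgroup of order at least [p ^ 3]. *)
have leZS : #|'Z(S)| <= p.
  rewrite leqNgt; apply: contra not_cSS => ltpZ.
  apply/center_idP/eqP; rewrite eqEsubset center_sub; apply/subsetP=> x Sx.
  apply/negPn/negP=> Z'x.
  pose E := 'Z(S) <*> <[x]>.
  have cEE : abelian E.
    rewrite abelianY center_abelian cycle_abelian cycle_subG.
    by apply/centP=> z /(centerC Sx).
  have sES : E \subset S by rewrite join_subG center_sub cycle_subG.
  have ltZE : 'Z(S) \proper E.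
    rewrite properE joing_subl join_subG subxx cycle_subG //.
  have := smallE _ sES cEE; apply/negP; rewrite -ltnNge.
  move: (proper_card ltZE) ltpZ.
  rewrite (card_pgroup (pgroupS (center_sub S) pS)).
  rewrite (card_pgroup (pgroupS sES pS)) !ltn_exp2l // => ltZE' ltpZ.
  by apply: leq_trans ltZE'; rewrite ltnS -(ltn_exp2l _ _ p_gt1) expn1.
have oG' : #|G^`(1)| = p.
  have [_ /dvdn_leq leG' _] := pgroup_pdiv pPhi ntG'.
  apply/eqP; rewrite eqn_leq leG' ?cardG_gt0 // andbT.
  by rewrite (leq_trans (subset_leq_card sG'ZS)).
have defZS : 'Z(S) = G^`(1).
  by apply/eqP; rewrite eq_sym eqEcard sG'ZS oG'.
have oG : #|G| = (p ^ 4)%N.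
  by rewrite -(Lagrange (der_sub 1 G)) oG' oGG' -expnS.
(* An extraspecial group has order an odd power of p, so S != G. *)
have not_sGS : ~~ (G \subset S).
  apply/negP=> sGS; have defS : S :=: G by apply/eqP; rewrite eqEsubset sSG.
  have esG : extraspecial G.
    split; last by rewrite -defS defZS oG'.
    by split; rewrite -?defPhi -defZS defS.
  have [n _] := card_extraspecial pG esG; rewrite oG => /(congr1 (logn p)).
  by rewrite !pfactorK // => /(congr1 odd); rewrite /= odd_double.
have oS : #|S| = (p ^ 3)%N.
  have ltSG : #|S| < #|G| by rewrite proper_card // properE sSG.
  move: leS ltSG; rewrite oG (card_pgroup pS) leq_exp2l // ltn_exp2l // ltnS.
  by move=> le3S leS3; congr (p ^ _)%N; apply/eqP; rewrite eqn_leq leS3.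
have leS3 : logn p #|S| <= 3 by rewrite oS pfactorK.
have esS : extraspecial S := p3group_extraspecial pS not_cSS leS3.
have [[_ defS'] _] := esS.
pose C := 'C_G(S).
have defG : C \* S = G.
  rewrite cprodC; apply: (critical_extraspecial pG sSG esS).
  by rewrite defS' defZS commSg.
have tiCS : C :&: S = 'Z(S) by rewrite setIAC (setIidPr sSG).
have pC : p.-group C := pgroupS (subsetIl _ _) pG.
have oC : #|C| = (p ^ 2)%N.
  have [_ defCS _] := cprodP defG.
  apply/eqP; rewrite -(eqn_pmul2r (cardG_gt0 S)); apply/eqP.
  by rewrite mul_cardG defCS tiCS defZS oG oG' oS -expnSr -expnD.
have [x Cx S'x] : exists2 x, x \in C & x \notin S.
  apply/subsetPn; apply/negP=> /setIidPl sCS.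
  move: oC; rewrite -sCS tiCS defZS oG' => /(congr1 (logn p)).
  by rewrite pfactorK // logn_prime // eqxx.
have Gx : x \in G by case/setIP: Cx.
(* Outside the kernel [S], [x] has order at least [p ^ 2], the order of [C]. *)
have defC : C = <[x]>.
  apply/eqP; rewrite eq_sym eqEcard cycle_subG Cx oC.
  have [n ox] := p_natP (mem_p_elt pG Gx).
  rewrite -orderE ox leq_exp2l // ltnNge; apply: contra S'x => le_n1.
  by rewrite memS Gx -order_dvdn ox (dvdn_exp2l p le_n1).
have cycC : cyclic C by rewrite defC cycle_cyclic.
have ntC : C != 1 by rewrite -cardG_gt1 oC -[1%N](exp1n 2) ltn_exp2r.
exists C, S; split=> //.
- split=> //; apply: prime_nt_dvdP; rewrite // -dvdn1 -trivg_exponent.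
  by apply: contraNneq not_cSS => ->; apply: abelian1.
apply/eqP; rewrite eqEcard /= defZS oG'.
rewrite (Ohm1_cyclic_pgroup_prime cycC pC ntC) leqnn andbT -defZS.
rewrite -tiCS subsetI Ohm_sub (OhmE 1 pC) gen_subG.
apply/subsetP=> y /LdivP[Cy yp1]; rewrite memS (subsetP (subsetIl _ _) y Cy).
exact/eqP.
Qed.

(** * Excluding class at least 3 *)

Lemma d_maximal_not_card_lcn3 (p : nat) (gT : finGroupType) (G : {group gT}) :
    prime p -> 2 < p -> p.-group G -> ~~ abelian G -> d_maximal G ->
    'm(G) = 3 -> #|[~: G^`(1), G]| != p.
Proof.
move=> p_pr p_gt2 pG not_cGG dmaxG dG; apply/eqP=> oN.
pose N : {group gT} := [group of [~: G^`(1), G]].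
have nilG := pgroup_nil pG.
have nsNG : N <| G by rewrite /normal /= (lcn_sub 3) (lcn_norm 3).
have [sNG nNG] := andP nsNG.
have cGN : N \subset 'Z(G).
  apply: prime_meetG; rewrite ?oN // (meet_center_nil nilG nsNG) //.
  by rewrite -cardG_gt1 oN prime_gt1.
have sNG' : N \subset G^`(1) by rewrite commg_subl der_norm.
have sNPhi : N \subset 'Phi(G) by rewrite -(d_maximal_der1 pG dmaxG).
have not_sG'Z : ~~ (G^`(1) \subset 'Z(G)).
  rewrite subsetI der_sub /=; apply/commG1P=> N1.
  by move: p_pr; rewrite -oN N1 cards1.
have not_cQQ : ~~ abelian (G / N).
  by apply: contra not_sG'Z => cQQ; apply: subset_trans cGN; apply: der1_min.
have dmaxQ := d_maximal_quotient nsNG sNPhi dmaxG.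
have pQ := quotient_pgroup N pG.
have [||C [S]] := d_maximal_class2 p_pr p_gt2 pQ not_cQQ dmaxQ.
- by rewrite grank_quotient_Phi.
- rewrite -quotient_der // subsetI quotientS ?der_sub //=.
  exact: quotient_cents2r.
case=> [[/cyclicP[xb defC] oC] [[[_ defS'] _] _ _] defQ _ defOhm].
have [_ mulCS cCS] := cprodP defQ.
have Cxb : xb \in C by rewrite defC cycle_id.
have : xb \in G / N by rewrite -mulCS (subsetP (mulG_subl S C)).
case/morphimP=> x Nx Gx def_xb.
have pxb : p.-elt xb by rewrite /p_elt orderE -defC oC pnatX pnat_id.
have cxQ : xb \in 'C(G / N).
  have cSC : C \subset 'C(S) by rewrite centsC.
  rewrite -mulCS centM inE (subsetP cSC) //.
  by rewrite defC cent_cycle cent1id.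
have xpZ : x ^+ p \in 'Z(G).
  rewrite inE groupX //=; apply/centP=> y Gy; apply/commgP.
  have Nxy : [~ x, y] \in N.
    apply: coset_idr; first by rewrite groupR ?(subsetP nNG).
    rewrite morphR ?(subsetP nNG) //= -def_xb; apply/eqP/commgP.
    by apply: (centP cxQ); apply: mem_quotient.
  rewrite commXg; last first.
    by apply: (centerC Gx); apply: (subsetP cGN).
  by rewrite -[p]oN expg_cardG.
case/negP: not_sG'Z.
suffices : G^`(1) \subset N <*> <[x ^+ p]>.
  move/subset_trans; apply.
  by rewrite join_subG cGN cycle_subG.
rewrite norm_joinEr ?cycle_subG ?groupX //.
rewrite -quotientSK ?(subset_trans (der_sub 1 G)) //.
rewrite quotient_cycle ?groupX // morphX //= -def_xb quotient_der //.
have C'1 : C^`(1) = 1 by apply/commG1P; rewrite defC -abelianE cycle_abelian.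
have := der_cprod 1 defQ; rewrite C'1 cprod1g => <-.
rewrite defS' -defOhm defC (Ohm_p_cycle 1 pxb) orderE -defC oC pfactorK //.
Qed.

(** If [L] were nontrivial, dividing by a normal subgroup of [G] of index [p] in [L] would give the
    excluded case of order [p]. *)
Lemma d_maximal_der1_center (p : nat) (gT : finGroupType) (G : {group gT}) :
    prime p -> 2 < p -> p.-group G -> ~~ abelian G -> d_maximal G ->
    'm(G) = 3 -> G^`(1) \subset 'Z(G).
Proof.
move=> p_pr p_gt2 pG not_cGG dmaxG dG; rewrite subsetI der_sub /=.
apply/commG1P/eqP/negPn/negP=> ntL.
pose L : {group gT} := [group of [~: G^`(1), G]].
have nsLG : L <| G by rewrite /normal /= (lcn_sub 3) (lcn_norm 3).
have pL : p.-group L := pgroupS (normal_sub nsLG) pG.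
have [_ _ [m oL]] := pgroup_pdiv pL ntL.
have lem : m <= logn p #|L| by rewrite oL pfactorK.
have [N [sNL nsNG oN]] := normal_pgroup pG nsLG lem.
have [_ nNG] := andP nsNG.
have sLG' : L \subset G^`(1) by rewrite commg_subl der_norm.
have sNPhi : N \subset 'Phi(G).
  by rewrite -(d_maximal_der1 pG dmaxG) (subset_trans sNL).
have oLN : #|L / N| = p.
  rewrite card_quotient ?(subset_trans (normal_sub nsLG)) //.
  by rewrite -divgS // oL oN expnS mulnK ?expn_gt0 ?prime_gt0.
have defLN : [~: (G / N)^`(1), G / N] = L / N.
  by rewrite -quotient_der // -quotientR // (subset_trans (der_sub 1 G)).
have := @d_maximal_not_card_lcn3 p _ (G / N)%G p_pr p_gt2.
rewrite defLN oLN eqxx => notP.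
suffices : false by []; apply: notP; rewrite ?quotient_pgroup //.
- apply/negP=> cQQ; move: (prime_gt1 p_pr).
  have Q'1 : (G / N)^`(1) = 1 by apply/commG1P.
  by rewrite -oLN -defLN Q'1 comm1G cards1.
- exact: d_maximal_quotient.
by rewrite grank_quotient_Phi.
Qed.

(** * The presentation *)

Definition relators (p : nat) (gT : finGroupType) (a b c : gT) : Prop :=
  [/\ a ^+ (p ^ 2) = 1, b ^+ p = 1 & c ^+ p = 1]
  /\ [/\ [~ a, b] = 1, [~ a, c] = 1 & [~ b, c] = a ^+ p].

Lemma card_relators_leq (p : nat) (gT : finGroupType) (a b c : gT) :
    0 < p -> relators p a b c ->
  #|<[a]> <*> <[b]> <*> <[c]>| <= p ^ 4.
Proof.
move=> p_gt0 [[ap bp cp] [ab ac bc]].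
have le_order x n : 0 < n -> x ^+ n = 1 -> #|<[x : gT]>| <= n.
  by move=> n_gt0 /eqP; rewrite -order_dvdn => /dvdn_leq; apply.
have cAB : <[b]> \subset 'C(<[a]>).
  by rewrite cents_cycle //; apply/esym/commgP/eqP.
have nABc : <[c]> \subset 'N(<[a]> <*> <[b]>).
  have [ABa ABb] : a \in <[a]> <*> <[b]> /\ b \in <[a]> <*> <[b]>.
    by rewrite !mem_gen // inE cycle_id ?orbT.
  (* Conjugation by [c] fixes [a] and sends [b] to [b * a ^+ p]. *)
  rewrite cycle_subG inE conjYg -!cycleJ !conjg_mulR ac bc mulg1.
  by rewrite join_subG !cycle_subG ABa groupM ?groupX.
have leY (A B : {group gT}) : B \subset 'N(A) -> #|A <*> B| <= #|A| * #|B|.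
  by move=> nAB; rewrite norm_joinEr // mul_cardG leq_pmulr ?cardG_gt0.
apply: leq_trans (leY _ _ nABc) _; rewrite (expnSr p 3) leq_mul ?le_order //.
apply: leq_trans (leY _ _ (cents_norm cAB)) _.
by rewrite (expnSr p 2) leq_mul ?le_order // expn_gt0 p_gt0.
Qed.

Lemma homGrp_relatorsP (p : nat) (gT : finGroupType) (G : {group gT}) :
  reflect
    (exists a b c, <[a]> <*> <[b]> <*> <[c]> = G /\ relators p a b c)
    (G \homg Grp (a : b : c : a ^+ (p ^ 2)%N, b ^+ p, c ^+ p,
                  [~ a, b], [~ a, c], [~ b, c] = a ^+ p)).
Proof.
apply: (iffP existsP) => /= [[[[a b] c]] | [a [b [c [defG]]]]].
  rewrite !xpair_eqE => /andP[/eqP defG].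
  case/and5P=> /eqP ap /eqP bp /eqP cp /eqP ab /andP[/eqP ac /eqP bc].
  by exists a, b, c.
case=> [[ap bp cp] [ab ac bc]].
by exists (a, b, c); rewrite /= defG ap bp cp ab ac bc.
Qed.

(* A group H satisfying the relations is a quotient of the subgroup D of
   gT * rT generated by the pairs of generators; D satisfies the relations too,
   so the order bound forces the projection of D onto G to be injective. *)
Lemma isoGrp_relators (p : nat) (gT : finGroupType) (G : {group gT})
    (a b c : gT) :
    0 < p -> <[a]> <*> <[b]> <*> <[c]> = G -> relators p a b c ->
    #|G| = (p ^ 4)%N ->
  G \isog Grp (a : b : c : a ^+ (p ^ 2)%N, b ^+ p, c ^+ p,
                  [~ a, b], [~ a, c], [~ b, c] = a ^+ p).
Proof.
move=> p_gt0 defG relG oG; apply: intro_isoGrp => [|rT H].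
  by apply/homGrp_relatorsP; exists a, b, c.
case/homGrp_relatorsP=> [a' [b' [c' [defH relH]]]].
pose D := (<[(a, a')]> <*> <[(b, b')]> <*> <[(c, c')]>)%G.
have leD : #|D| <= #|G|.
  rewrite oG; apply: card_relators_leq => //.
  have pairX (x : gT) (y : rT) n : (x, y) ^+ n = (x ^+ n, y ^+ n).
    by elim: n => // n IHn; rewrite !expgS IHn.
  have pairR (x1 x2 : gT) (y1 y2 : rT) :
    [~ (x1, y1), (x2, y2)] = ([~ x1, x2], [~ y1, y2]) by [].
  case: relG => [[ap bp cp] [ab ac bc]].
  case: relH => [[ap' bp' cp'] [ab' ac' bc']].
  split; split; rewrite ?pairX ?pairR; congr (_, _) => //.
have imD1 : [morphism of fst] @* D = G.
  rewrite /= !morphimY ?morphim_cycle ?subsetT ?inE //.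
have imD2 : [morphism of snd] @* D = H.
  rewrite /= !morphimY ?morphim_cycle ?subsetT ?inE //.
have isoGD : G \isog D.
  by rewrite isogEcard leD andbT -imD1 morphim_homg ?subsetT.
have homHD : H \homg D by rewrite -imD2 morphim_homg ?subsetT.
by apply: homg_trans homHD (isog_hom _); rewrite isog_sym.
Qed.

(** Any noncommuting [b] and [c] in [S] will do, with [a] a generator of [C] chosen so that its
    [p]-th power is [[~ b, c]]. *)
Lemma cprod_cyclic_extraspecial_relators (p : nat) (gT : finGroupType)
    (G : {group gT}) :
    prime p -> cprod_cyclic_extraspecial p G ->
  #|G| = (p ^ 4)%N
  /\ exists a b c, <[a]> <*> <[b]> <*> <[c]> = G /\ relators p a b c.
Proof.
move=> p_pr [C [S [[cycC oC] [esS oS expS] defG tiCS defOhm]]].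
have pS : p.-group S by rewrite /pgroup oS pnatX pnat_id.
have pC : p.-group C by rewrite /pgroup oC pnatX pnat_id.
have oZ := card_center_extraspecial pS esS.
have [_ mulCS cCS] := cprodP defG.
have p_gt1 := prime_gt1 p_pr.
split.
  apply/eqP; rewrite -(eqn_pmul2r (prime_gt0 p_pr)); apply/eqP.
  by rewrite -{1}oZ -tiCS -mulCS -mul_cardG oC oS -expnD -expnSr.
have [b Sb [c Sc ntbc]] :
    exists2 b, b \in S & exists2 c, c \in S & [~ b, c] != 1.
  suffices /exists_inP[b Sb /exists_inP[c Sc ntbc]] :
      [exists b in S, exists c in S, [~ b, c] != 1].
    by exists b; last exists c.
  apply: contraR (extraspecial_nonabelian esS) => cSS.
  apply/centsP=> b Sb c Sc; apply/commgP; apply: contraR cSS => ntbc.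
  by apply/exists_inP; exists b => //; apply/exists_inP; exists c.
have [[_ defS'] _] := esS.
have Zbc : [~ b, c] \in 'Ohm_1(C) by rewrite defOhm -defS' mem_commg.
have [a0 defC] := cyclicP cycC.
have pa0 : p.-elt a0 by rewrite /p_elt orderE -defC.
have [a defCa def_bc] : exists2 a, C :=: <[a]> & [~ b, c] = a ^+ p.
  move: Zbc; rewrite defC (Ohm_p_cycle 1 pa0) orderE -defC oC pfactorK //.
  case/cycleP=> k def_bc.
  (* This still generates [C]: if [p] divided [k], then [[~ b, c]] would be a power of
     [a0 ^+ (p ^ 2)], hence trivial. *)
  exists (a0 ^+ k); last by rewrite def_bc -!expgM mulnC.
  apply/eqP; rewrite defC -[_ == _]/(generator <[a0]> (a0 ^+ k)).
  rewrite generator_coprime orderE -defC oC.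
  rewrite coprimeXl // prime_coprime //; apply: contra ntbc => /dvdnP[j def_k].
  rewrite def_bc def_k -expgM mulnCA -expnSr mulnC expgM -oC defC -orderE.
  by rewrite expg_order expg1n.
exists a, b, c.
have expSp x : x \in S -> x ^+ p = 1 by rewrite -expS; apply: expg_exponent.
have ca x : x \in S -> [~ a, x] = 1.
  move=> Sx; apply/eqP/commgP/esym/(centsP cCS) => //.
  by rewrite defCa cycle_id.
split; last first.
  split; split; auto; apply/eqP.
  by rewrite -order_dvdn orderE -defCa oC.
(* A subgroup of order at most [p ^ 2] is abelian and cannot contain both [b] and [c]. *)
have defS : <[b]> <*> <[c]> = S.
  apply/eqP; rewrite eqEcard join_subG !cycle_subG Sb Sc oS /=.
  have pbc : p.-group (<[b]> <*> <[c]>).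
    by apply: pgroupS pS; rewrite join_subG !cycle_subG Sb.
  rewrite (card_pgroup pbc) leq_exp2l // ltnNge; apply: contra ntbc => le2.
  have := p2group_abelian pbc le2.
  by move/centsP=> cbc; apply/commgP/cbc; rewrite mem_gen // inE cycle_id ?orbT.
by rewrite -joingA defS -defCa (cprodWY defG).
Qed.

Theorem proposition4p3 (p : nat) (gT : finGroupType) (G : {group gT})
    (p_prime : prime p) (p_gt2 : 2 < p)
    (pG : p.-group G) (not_cGG : ~~ abelian G)
    (dmaxG : d_maximal G) (dG : 'm(G) = 3) :
  cprod_cyclic_extraspecial p G
  /\ G \isog Grp (a : b : c : a ^+ (p ^ 2)%N, b ^+ p, c ^+ p,
                  [~ a, b], [~ a, c], [~ b, c] = a ^+ p).
Proof.
have cprodG : cprod_cyclic_extraspecial p G.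
  apply: d_maximal_class2 => //; exact: d_maximal_der1_center pG _ _ _.
have [oG [a [b [c [defG relG]]]]] :=
  cprod_cyclic_extraspecial_relators p_prime cprodG.
by split=> //; apply: isoGrp_relators defG relG oG; apply: prime_gt0.
Qed.
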